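(* For every integer $n\ge 1$ there is a constant $C=C(n)$, depending only on $n$, such that the following holds. Let $\mathbb{F}$ be any field, let $k_1,\ldots,k_d\ge 1$ be integers with $k_1+\cdots+k_d=n$, and for each $1\le j\le d$ let $\Pi_j$ be a set of affine $k_j$-planes in $\mathbb{F}^n$. Let \[J=\{p\in\mathbb{F}^n:\ \exists(\pi_1,\ldots,\pi_d)\in\Pi_1\times\cdots\times\Pi_d\text{ such that }\delta(p,\pi_1,\ldots,\pi_d)=1\}.\] Then for every finitely supported function $S:J\to\mathbb{R}_{\ge0}$ with $\|S\|_d=1$ there exists, for each $1\le j\le d$, a function $s_{k_j}:J\times\mathrm{Gr}(k_j,\mathbb{F}^n)\to\mathbb{R}_{\ge 0}$ such that \[\delta(p,\pi_1,\ldots,\pi_d)\,S(p)^d\le C\prod_{j=1}^d s_{k_j}(p,e(\pi_j))\] for all $p\in J$ and all $(\pi_1,\ldots,\pi_d)\in\Pi_1\times\cdots\times\Pi_d$, and such that \[\sum_{p\in\pi_j\cap J}s_{k_j}(p,e(\pi_j))=1\] for all $\pi_j\in\Pi_j$ and all $1\le j\le d$.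
   Context: $\mathrm{Gr}(k,\mathbb{F}^n)$ is the set of all $k$-dimensional linear subspaces of $\mathbb{F}^n$. For an affine $k$-plane $\pi\subset\mathbb{F}^n$, $e(\pi)\in\mathrm{Gr}(k,\mathbb{F}^n)$ is the translate of $\pi$ containing the origin. For linear subspaces $V_1,\ldots,V_d$ of $\mathbb{F}^n$ of dimensions $k_1,\ldots,k_d$ with $k_1+\cdots+k_d=n$, the discrete wedge product $V_1\wedge\cdots\wedge V_d\in\{0,1\}$ equals $1$ if $V_1,\ldots,V_d$ together span $\mathbb{F}^n$, and $0$ otherwise. The multijoint kernel is \[\delta(p,\pi_1,\ldots,\pi_d)=\Big(\prod_{j=1}^d\chi_{\pi_j}(p)\Big)\,e(\pi_1)\wedge\cdots\wedge e(\pi_d),\] where $\chi_{\pi_j}$ is the indicator function of $\pi_j$. $\|S\|_d=\left(\sum_{p\in J}S(p)^d\right)^{1/d}$.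
   Formalization: The normalisation that the sum over p in π_j∩J equals 1 is required only for those π_j in Π_j that meet J; for a plane containing no multijoint the sum is empty, hence 0, and the condition cannot hold. *)

(* Defs.v *)
From mathcomp Require Import all_boot all_order all_algebra.
From mathcomp Require Import all_classical all_reals all_analysis.

Set Implicit Arguments.
Unset Strict Implicit.
Unset Printing Implicit Defensive.

Import Order.TTheory GRing.Theory Num.Theory.

Local Open Scope classical_set_scope.
Local Open Scope ring_scope.

Definition Gr (F : fieldType) (n k : nat) : Type :=
  {V : {vspace 'rV[F]_n} | \dim V == k}.

Definition translate (F : fieldType) (n k : nat) (p : 'rV[F]_n)
    (V : Gr F n k) : set 'rV[F]_n :=
  [set p + v | v in [set v | v \in val V]].

Record aplane (F : fieldType) (n k : nat) : Type := APlane {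
  aplane_set :> set 'rV[F]_n ;
  aplaneP : exists (V : Gr F n k) (p : 'rV[F]_n), aplane_set = translate p V }.

(* The choice is harmless: [dir_unique] shows that it is the only subspace
   of which pi is a translate. *)
Definition dir (F : fieldType) (n k : nat) (pi : aplane F n k) : Gr F n k :=
  sval (cid (aplaneP pi)).

Lemma dir_translate (F : fieldType) (n k : nat) (pi : aplane F n k) :
  exists p, pi = translate p (dir pi) :> set _.
Proof. by rewrite /dir; case: cid. Qed.

Lemma dir_unique (F : fieldType) (n k : nat) (pi : aplane F n k)
    (V : Gr F n k) (p : 'rV[F]_n) :
  pi = translate p V :> set _ -> dir pi = V.
Proof.
have [q] := dir_translate pi; move: (dir pi) => W -> eWV.
have sub (A B : Gr F n k) (a b : 'rV[F]_n) :
    translate a A = translate b B -> (val A <= val B)%VS.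
  move=> e; apply/subvP => v vA.
  have : translate b B (a + v) by rewrite -e; exists v.
  have : translate b B a by rewrite -e; exists 0; rewrite /= ?mem0v ?addr0.
  move=> [u /= uB <-] [w /= wB /eqP].
  rewrite -addrA (inj_eq (addrI _)) => /eqP wE.
  by rewrite -(addKr u v) -wE memvD ?memvN.
by apply/val_inj/eqP; rewrite eqEsubv (sub _ _ _ _ eWV) (sub _ _ _ _ (esym eWV)).
Qed.

Definition wedge (F : fieldType) (n d : nat) (k : 'I_d -> nat)
    (V : forall j, Gr F n (k j)) : nat :=
  if (\sum_(j < d) val (V j))%VS == fullv then 1%N else 0%N.

Definition mjkernel (F : fieldType) (n d : nat) (k : 'I_d -> nat)
    (p : 'rV[F]_n) (pi : forall j, aplane F n (k j)) : nat :=
  ((\prod_(j < d) (p \in (pi j : set 'rV[F]_n))) *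
     wedge (fun j => dir (pi j)))%N.

Definition multijoints (F : fieldType) (n d : nat) (k : 'I_d -> nat)
    (Pi : forall j, set (aplane F n (k j))) : set 'rV[F]_n :=
  [set p | exists pi : forall j, aplane F n (k j),
     (forall j, Pi j (pi j)) /\ mjkernel p pi = 1%N].

(* Meaningful for S with finite support in J: the \sum_(_ \in _) of a family
   with infinite support is 0 by convention. *)
Definition norm_d (R : realType) (T : choiceType) (J : set T) (d : nat)
    (S : T -> R) : R :=
  (\sum_(p \in J) S p ^+ d) `^ (d%:R^-1).

(* Main.v *)
From HB Require Import structures.
From mathcomp Require Import all_boot all_order all_algebra.
From mathcomp Require Import boolp.
From mathcomp Require mpoly.
From mathcomp Require Import zify ring lra.

Set Implicit Arguments.
Unset Strict Implicit.
Unset Printing Implicit Defensive.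

Import Order.TTheory GRing.Theory Num.Theory.

Local Open Scope ring_scope.

(* The polynomial method with handicaps of Tidor, Yu and Zhao. Give every
   point p of the support of S a delay be p, and impose on polynomials of
   degree at most D the vanishing conditions of order 0, 1, 2, ... at the
   points, those of order r at p coming at time r + be p. On a flat pi, let
   b(p, pi) count the conditions at p that are independent of the earlier
   ones. Then the b(p, pi), p in pi, add up to the dimension of the space of
   polynomials of degree at most D on pi, and, looking at the first condition
   violated by a polynomial on the whole space, sum_p prod_j b(p, pi_j) is at
   least 'C(n + D, n) for any choice of transversal flats pi_j through p. This
   holds also for a set of points well ahead of all the others.
   Making p earlier increases b(p, .) by a relative O(1/D) only and decreases
   all the other b(q, .). So start with large equal delays, and as long as
   prod_j b(p, pi_j) < S(p)^d 'C(n + D, n) / 2 for some p and some pi_j,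
   decrease the delay of p. A point that has moved always satisfies
   prod_j b(p, pi_j) < S(p)^d 'C(n + D, n) for some pi_j, so by the previous
   bound and sum_p S(p)^d = 1 the process stops. Then s = b / dimension,
   increased at one point of each flat to make the total 1, is as wanted. *)

Section Multinomials.
Import mpoly.

(** * Polynomials by order and degree, and their restriction to affine flats *)

Section AffineRestriction.
Variable F : fieldType.

(** The lower bound expresses vanishing to order a at the origin, the upper bound the degree; the
    zero polynomial lies in every band. *)
Definition band n (a b : nat) (p : {mpoly F[n]}) :=
  forall m, p@_m != 0 -> (a <= mdeg m <= b)%N.

Lemma band0 n a b : band a b (0 : {mpoly F[n]}).
Proof. by move=> m; rewrite mcoeff0 eqxx. Qed.

Lemma bandD n a b (p q : {mpoly F[n]}) :
  band a b p -> band a b q -> band a b (p + q).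
Proof.
move=> hp hq m; rewrite mcoeffD => h.
have [p0|] := eqVneq p@_m 0; last exact: hp.
by apply: hq; rewrite p0 add0r in h.
Qed.

Lemma bandZ n a b c (p : {mpoly F[n]}) : band a b p -> band a b (c *: p).
Proof.
by move=> hp m; rewrite mcoeffZ mulf_eq0 negb_or => /andP[_]; apply: hp.
Qed.

Lemma band_sum n a b (I : Type) (r : seq I) (P : pred I) (f : I -> {mpoly F[n]}) :
  (forall i, P i -> band a b (f i)) -> band a b (\sum_(i <- r | P i) f i).
Proof.
move=> h; elim/big_rec: _ => [|i p Pi hp]; first exact: band0.
by apply: bandD => //; apply: h.
Qed.

Lemma bandM n a b a' b' (p q : {mpoly F[n]}) :
  band a b p -> band a' b' q -> band (a + a') (b + b') (p * q).
Proof.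
move=> hp hq m; rewrite -mcoeff_msupp => /msuppM_le /allpairsP[[m1 m2]] /=.
rewrite !mcoeff_msupp => -[/hp /andP[h1 h2] /hq /andP[h3 h4] ->].
by rewrite mdegD !leq_add.
Qed.

Lemma bandC n (c : F) : band 0 0 (c%:MP : {mpoly F[n]}).
Proof.
move=> m; rewrite mcoeffC; have [->|] := eqVneq m 0%MM; first by rewrite mdeg0.
by rewrite mulr0 eqxx.
Qed.

Lemma bandX n (i : 'I_n) : band 1 1 ('X_i : {mpoly F[n]}).
Proof.
move=> m; rewrite mcoeffX; have [<-|] := eqVneq U_(i)%MM m; first by rewrite mdeg1.
by rewrite eqxx.
Qed.

Lemma band_exp n a b e (p : {mpoly F[n]}) :
  band a b p -> band (a * e) (b * e) (p ^+ e).
Proof.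
move=> hp; elim: e => [|e IH].
  by rewrite !muln0 expr0 -mpolyC1; apply: bandC.
by rewrite exprS !mulnS; apply: bandM.
Qed.

Lemma band_prod n (I : Type) (r : seq I) (f : I -> {mpoly F[n]}) (a b : I -> nat) :
  (forall i, band (a i) (b i) (f i)) ->
  band (\sum_(i <- r) a i) (\sum_(i <- r) b i) (\prod_(i <- r) f i).
Proof.
move=> h; elim: r => [|i r IH].
  by rewrite !big_nil -mpolyC1; apply: bandC.
by rewrite !big_cons; apply: bandM.
Qed.

Lemma sub_band n a b a' b' (p : {mpoly F[n]}) :
  (a' <= a)%N -> (b <= b')%N -> band a b p -> band a' b' p.
Proof.
by move=> ha hb h m /h /andP[h1 h2]; rewrite (leq_trans ha h1) (leq_trans h2 hb).
Qed.

Lemma band_comp n k a b r D (lq : n.-tuple {mpoly F[k]}) (p : {mpoly F[n]}) :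
  (forall i, band a b (tnth lq i)) -> band r D p ->
  band (a * r) (b * D) (p \mPo lq).
Proof.
move=> hq hp; rewrite comp_mpolyE big_seq; apply: band_sum => m.
rewrite mcoeff_msupp => /hp /andP[h1 h2]; apply: bandZ.
have h i : band (a * m i) (b * m i) (tnth lq i ^+ m i) by apply: band_exp.
have := band_prod (r := index_enum _) h.
rewrite -!big_distrr /= -mdegE; apply: sub_band; rewrite leq_mul2l ?h1 ?h2 orbT //.
Qed.

Definition aff k n (A : 'M[F]_(k, n)) (c : 'rV_n) : n.-tuple {mpoly F[k]} :=
  [tuple \sum_l A l i *: 'X_l + (c 0 i)%:MP | i < n].

(* The polynomial u |-> g (c + u A). *)
Definition restr k n (A : 'M[F]_(k, n)) (c : 'rV_n) (g : {mpoly F[n]}) :=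
  g \mPo aff A c.

HB.instance Definition _ k n (A : 'M[F]_(k, n)) c :=
  GRing.Linear.copy (restr A c) (comp_mpoly (aff A c)).
HB.instance Definition _ k n (A : 'M[F]_(k, n)) c :=
  GRing.RMorphism.copy (restr A c) (comp_mpoly (aff A c)).

Lemma restrX k n (A : 'M[F]_(k, n)) c i :
  restr A c 'X_i = \sum_l A l i *: 'X_l + (c 0 i)%:MP.
Proof. by rewrite /restr comp_mpolyXU -tnth_nth tnth_mktuple. Qed.

Lemma restrZ k n (A : 'M[F]_(k, n)) c a g : restr A c (a *: g) = a *: restr A c g.
Proof. exact: linearZ. Qed.

Lemma restr_sum k n (A : 'M[F]_(k, n)) c (I : Type) (r : seq I) (P : pred I) f :
  restr A c (\sum_(i <- r | P i) f i) = \sum_(i <- r | P i) restr A c (f i).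
Proof. exact: raddf_sum. Qed.

Lemma restr_mpolyC k n (A : 'M[F]_(k, n)) c a : restr A c a%:MP = a%:MP.
Proof. exact: comp_mpolyC. Qed.

Lemma eq_rmorph_mpoly n (S : nzRingType) (f g : {rmorphism {mpoly F[n]} -> S}) :
  (forall c, f c%:MP = g c%:MP) -> (forall i, f 'X_i = g 'X_i) -> f =1 g.
Proof.
move=> hC hX p; rewrite (mpolyE p) !rmorph_sum /=; apply: eq_bigr => m _.
rewrite -mul_mpolyC !rmorphM hC /= mpolyXE_id !rmorph_prod /=; congr (_ * _).
by apply: eq_bigr => i _; rewrite !rmorphXn hX.
Qed.

Lemma restr_comp l k n (A : 'M[F]_(k, n)) c (B : 'M[F]_(l, k)) e g :
  restr B e (restr A c g) = restr (B *m A) (c + e *m A) g.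
Proof.
apply: (@eq_rmorph_mpoly n _ (restr B e \o restr A c) (restr (B *m A) (c + e *m A))).
  by move=> a /=; rewrite !restr_mpolyC.
move=> i /=; rewrite !restrX raddfD /= restr_mpolyC raddf_sum /=.
under eq_bigr => j _ do rewrite linearZ /= restrX scalerDr scaler_sumr.
rewrite big_split /= exchange_big /= -addrA; congr (_ + _).
  apply: eq_bigr => j _; rewrite !mxE scaler_suml; apply: eq_bigr => x _.
  by rewrite scalerA mulrC.
rewrite !mxE addrC mpolyCD; congr (_ + _); rewrite raddf_sum /=.
by apply: eq_bigr => j _; rewrite -mul_mpolyC -mpolyCM mulrC.
Qed.

Lemma restr_id n (g : {mpoly F[n]}) : restr 1%:M 0 g = g.
Proof.
rewrite -[RHS]comp_mpoly_id /restr; congr (_ \mPo _).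
apply: eq_from_tnth => i; rewrite !tnth_mktuple mxE mpolyC0 addr0.
rewrite (bigD1 i) //= big1 ?addr0; first by rewrite mxE eqxx scale1r.
by move=> j /negbTE h; rewrite mxE h scale0r.
Qed.

Lemma band_restr k n (A : 'M[F]_(k, n)) c D g :
  band 0 D g -> band 0 D (restr A c g).
Proof.
move=> hg; rewrite -[D]mul1n -[0%N]/(0 * 0)%N; apply: band_comp => // i.
rewrite tnth_mktuple; apply: bandD; last exact: (sub_band _ _ (@bandC _ _)).
by apply: band_sum => l _; apply: bandZ; apply: (sub_band _ _ (@bandX _ _)).
Qed.

(** A linear substitution maps homogeneous polynomials to homogeneous ones of the same degree, so
    the order at the origin cannot drop. *)
Lemma band_linear k n (A : 'M[F]_(k, n)) r D g :
  band r D g -> band r D (restr A 0 g).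
Proof.
move=> hg; rewrite -[r]mul1n -[D]mul1n; apply: band_comp => // i.
rewrite tnth_mktuple mxE mpolyC0 addr0.
by apply: band_sum => l _; apply: bandZ; apply: bandX.
Qed.

End AffineRestriction.

(** The hypothesis says that the rows of [M] are linearly independent vectors of F^T. All dimension
    counts below take this form, with rows or columns indexed by monomials. *)
Lemma leq_card_linear (F : fieldType) (S T : finType) (M : S -> T -> F) :
  (forall a : S -> F, (forall t, \sum_s a s * M s t = 0) -> forall s, a s = 0) ->
  (#|S| <= #|T|)%N.
Proof.
move=> inj; pose A : 'M[F]_(#|S|, #|T|) := \matrix_(i, j) M (enum_val i) (enum_val j).
have : row_free A.
  apply: inj_row_free => v vA; apply/rowP => i; rewrite mxE.
  rewrite -(enum_valK i); apply: (inj (fun s => v 0 (enum_rank s))) => t.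
  have /rowP/(_ (enum_rank t)) := vA; rewrite !mxE => vAt.
  rewrite -[RHS]vAt (reindex _ (onW_bij _ (enum_rank_bij S))).
  by apply: eq_bigr => s _; rewrite mxE !enum_rankK.
by rewrite /row_free => /eqP <-; apply: rank_leq_col.
Qed.

Lemma lexmin_exists (T : finType) (P : pred T) (u v : T -> nat) x0 :
  P x0 -> exists2 x, P x &
    forall y, P y -> (u x < u y)%N \/ u x = u y /\ (v x <= v y)%N.
Proof.
move=> Px0; have [x Px xmin] := arg_minnP u Px0.
have Px' : P x && (u x == u x) by rewrite Px eqxx.
have [y /andP[Py /eqP uy] ymin] := arg_minnP (P := [pred y | P y && (u y == u x)]) v Px'.
exists y => // z Pz; rewrite uy; have := xmin z Pz.
rewrite leq_eqVlt => /orP[/eqP uz|]; [right|by left].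
by split => //; apply: ymin; rewrite /= Pz uz eqxx.
Qed.

(** * Vanishing conditions at points and their pivots *)

Section Pivots.
Variable F : fieldType.

Definition shift k (c : 'rV[F]_k) (f : {mpoly F[k]}) := restr 1%:M c f.

Lemma shiftZ k (c : 'rV[F]_k) a f : shift c (a *: f) = a *: shift c f.
Proof. exact: restrZ. Qed.

Lemma shiftM k (c : 'rV[F]_k) f g : shift c (f * g) = shift c f * shift c g.
Proof. exact: rmorphM. Qed.

Lemma shift_sum k (c : 'rV[F]_k) (I : Type) (r : seq I) (P : pred I) f :
  shift c (\sum_(i <- r | P i) f i) = \sum_(i <- r | P i) shift c (f i).
Proof. exact: restr_sum. Qed.

Lemma shiftX k (e : 'rV[F]_k) i : shift e 'X_i = 'X_i + (e 0 i)%:MP.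
Proof.
rewrite /shift restrX (bigD1 i) //= big1 ?addr0 ?mxE ?eqxx ?scale1r //.
by move=> j /negbTE ji; rewrite mxE ji scale0r.
Qed.

Lemma shift_shift k (c e : 'rV[F]_k) f : shift e (shift c f) = shift (c + e) f.
Proof. by rewrite /shift restr_comp !mulmx1. Qed.

Lemma shift_eq0 k (c : 'rV[F]_k) f : (shift c f == 0) = (f == 0).
Proof.
apply/eqP/eqP => [h|->]; last by rewrite /shift raddf0.
by have := shift_shift c (- c) f; rewrite addrN h /shift raddf0 restr_id.
Qed.

Definition nmon k D := #|{: 'X_{1..k < D.+1}}|.

Lemma band_eqP k D (f g : {mpoly F[k]}) : band 0 D f -> band 0 D g ->
  (forall M : 'X_{1..k < D.+1}, f@_M = g@_M) -> f = g.
Proof.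
move=> hf hg h; apply/mpolyP => M.
have [lt|ge] := ltnP (mdeg M) D.+1; first exact: (h (BMultinom lt)).
have out (e : {mpoly F[k]}) : band 0 D e -> e@_M = 0.
  move=> he; apply/eqP; apply: contraTT ge.
  by move=> /he /andP[_]; rewrite -leqNgt.
by rewrite (out _ hf) (out _ hg).
Qed.

Definition poly_of k D (a : 'X_{1..k < D.+1} -> F) : {mpoly F[k]} :=
  \sum_M a M *: 'X_[M].

Lemma coef_poly_of k D (a : 'X_{1..k < D.+1} -> F) (M : 'X_{1..k < D.+1}) :
  (poly_of a)@_M = a M.
Proof.
rewrite /poly_of raddf_sum /= (bigD1 M) //= big1 ?addr0.
  by rewrite mcoeffZ mcoeffX eqxx mulr1.
move=> M' ne; rewrite mcoeffZ mcoeffX -bmeqP (negbTE ne) mulr0 //.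
Qed.

Lemma band_poly_of k D (a : 'X_{1..k < D.+1} -> F) : band 0 D (poly_of a).
Proof.
apply: band_sum => M _; apply: bandZ => M'; rewrite mcoeffX.
by have [<- _|_] := eqVneq (M : 'X_{1..k}) M'; rewrite ?eqxx //; apply: (bmdeg M).
Qed.

(** Once its constant term is removed, [g] has order at least 1, so its product with [f] has no
    monomial of degree at most r. *)
Lemma mcoeffM_low k r b (f g : {mpoly F[k]}) M : band r b f -> (mdeg M <= r)%N ->
  (f * g)@_M = f@_M * g@_0%MM.
Proof.
move=> hf hM; have hg : band 1 (msize g) (g - (g@_0%MM)%:MP).
  move=> M'; rewrite mcoeffB mcoeffC.
  have [->|h0] := eqVneq M' 0%MM; first by rewrite mulr1 subrr eqxx.
  rewrite mulr0 subr0 -mcoeff_msupp lt0n mdeg_eq0 h0 => /msize_mdeg_lt.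
  exact: ltnW.
have hfg := bandM hf hg.
rewrite -{1}(subrK (g@_0%MM)%:MP g) mulrDr mcoeffD.
rewrite [f * (g@_0)%:MP]mulrC mcoeffCM [in RHS]mulrC -[RHS]add0r; congr (_ + _).
by apply/eqP; apply: contraTT hM => /hfg /andP[+ _]; rewrite addn1 -ltnNge.
Qed.

Section Points.
Variables (m k : nat) (x : 'I_m -> 'rV[F]_k).
Implicit Types (be : 'I_m -> nat) (Q : {set 'I_m}).

(* The order in which the vanishing conditions are imposed: the conditions of
   order r at the point q come at time lev be q r, so be is a delay. *)
Definition lev be (q : 'I_m) r := ((r + be q) * m + q)%N.

Lemma lev_inj be p q r s : lev be p r = lev be q s -> p = q /\ r = s.
Proof.
move=> h; have pq : p = q.
  apply: val_inj; have := congr1 (modn^~ m) h; rewrite /lev.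
  by rewrite !modnMDl !modn_small // ltn_ord.
split => //; move: h; rewrite pq /lev; have := ltn_ord q; nia.
Qed.

Lemma levD be q r a : lev be q (r + a) = (lev be q r + a * m)%N.
Proof. by rewrite /lev; ring. Qed.

Lemma leq_lev be q r s : (r <= s)%N -> (lev be q r <= lev be q s)%N.
Proof. by move=> rs; rewrite /lev leq_add2r leq_mul2r leq_add2r rs orbT. Qed.

Lemma lev_le be p q r s : (r + be p < s + be q)%N -> (lev be p r <= lev be q s)%N.
Proof.
move=> lt; apply: (@leq_trans ((s + be q) * m)); last exact: leq_addr.
apply: (@leq_trans ((r + be p).+1 * m)); last by rewrite leq_mul2r lt orbT.
by rewrite mulSn [leqRHS]addnC /lev leq_add2l ltnW.
Qed.

(** The coefficients of [shift (x p) f] are the Taylor coefficients of f at [x p], which replace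
    derivatives in every characteristic. The conditions are totally ordered, by level and then by
    the code [pickle] of the monomial. For p in Q, (p, M) is a pivot when it is the first condition
    violated by some polynomial of degree at most D, that is, when it does not follow from the
    earlier ones. *)
Definition pivot D Q be (p : 'I_m) (M : 'X_{1..k}) :=
  exists f, [/\ band 0 D f, (shift (x p) f)@_M != 0,
    forall q M', q \in Q -> (lev be q (mdeg M') < lev be p (mdeg M))%N ->
      (shift (x q) f)@_M' = 0
  & forall M', mdeg M' = mdeg M -> (pickle M' < pickle M)%N ->
      (shift (x p) f)@_M' = 0].

Definition pivots D Q be p : {set 'X_{1..k < D.+1}} :=
  [set M : 'X_{1..k < D.+1} | `[< pivot D Q be p M >]].

Definition npiv D Q be p := #|pivots D Q be p|.

Let E D Q be := {e : 'I_m * 'X_{1..k < D.+1} | (e.1 \in Q) && (e.2 \in pivots D Q be e.1)}.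

Let card_E D Q be : #|{: E D Q be}| = (\sum_(p in Q) npiv D Q be p)%N.
Proof.
rewrite card_sig -sum1_card /npiv.
under [RHS]eq_bigr => p _ do rewrite -sum1_card.
by rewrite pair_big_dep.
Qed.

(** Witnesses of distinct pivots have distinct first violated conditions, so they are linearly
    independent among the polynomials of degree at most D. *)
Lemma sum_npiv_le D Q be : (\sum_(p in Q) npiv D Q be p <= nmon k D)%N.
Proof.
rewrite -card_E /nmon.
have /choice[f fP] (e : E D Q be) : exists f : {mpoly F[k]},
    [/\ band 0 D f, (shift (x (val e).1) f)@_(val e).2 != 0,
    forall q M', q \in Q -> (lev be q (mdeg M') < lev be (val e).1 (mdeg (val e).2))%N ->
      (shift (x q) f)@_M' = 0
  & forall M', mdeg M' = mdeg (val e).2 -> (pickle M' < pickle (bmnm (val e).2))%N ->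
      (shift (x (val e).1) f)@_M' = 0].
  by case: e => -[p M] /= /andP[_]; rewrite inE => /asboolP.
apply: (@leq_card_linear F _ _ (fun e (M : 'X_{1..k < D.+1}) => (f e)@_M)) => a a0.
have {}a0 : \sum_e a e *: f e = 0.
  apply: (@band_eqP _ D); [|exact: band0|].
    by apply: band_sum => e _; apply: bandZ; case: (fP e).
  move=> M; rewrite mcoeff0 -[RHS](a0 M) raddf_sum /=.
  by apply: eq_bigr => e _; rewrite mcoeffZ.
suff : forall e, ~~ (a e != 0) by move=> h e; apply/eqP; rewrite -[_ == _]negbK.
move=> e1; apply/negP => ae1.
(* At the earliest pivot e of a linear relation, all the other witnesses of the relation satisfy the
   condition, so the coefficient of e must vanish. *)
have [e ae emin] := @lexmin_exists _ (fun e => a e != 0)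
  (fun e => lev be (val e).1 (mdeg (val e).2)) (fun e => pickle (bmnm (val e).2)) e1 ae1.
have := congr1 (fun g => (shift (x (val e).1) g)@_(val e).2) a0.
rewrite /= shift_sum {2}/shift raddf0 mcoeff0 raddf_sum /= (bigD1 e) //= big1 ?addr0.
  by rewrite shiftZ mcoeffZ => /eqP; rewrite mulf_eq0 (negbTE ae); case: (fP e) => _ /negbTE ->.
move=> e' ne; rewrite shiftZ mcoeffZ; have [->|ae'] := eqVneq (a e') 0; first by rewrite mul0r.
have [_ _ h1 h2] := fP e'; case: (emin e' ae') => [lt|[/lev_inj[e1E e2E] le]].
  by rewrite h1 ?mulr0 //; case/andP: (valP e).
rewrite e1E h2 ?mulr0 // ltn_neqAle le andbT; apply: contra ne => /eqP/(pcan_inj pickleK) e2E'.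
apply/eqP/val_inj; rewrite [LHS]surjective_pairing [RHS]surjective_pairing e1E; congr pair.
by apply/eqP; rewrite bmeqP e2E'.
Qed.

(** The first condition violated by a nonzero polynomial is a pivot, so a polynomial is determined
    by its Taylor coefficients at the pivots. A point [p0] ensures that some condition is
    violated. *)
Lemma sum_npiv_ge D Q be p0 : p0 \in Q ->
  (nmon k D <= \sum_(p in Q) npiv D Q be p)%N.
Proof.
move=> p0Q; rewrite -card_E.
apply: (@leq_card_linear F _ _
  (fun (M : 'X_{1..k < D.+1}) (e : E D Q be) => (shift (x (val e).1) 'X_[M])@_(val e).2)).
move=> a a0 M0; rewrite -[LHS]coef_poly_of; set f := poly_of a.
suff /eqP -> : f == 0 by rewrite mcoeff0.
have {}a0 (e : E D Q be) : (shift (x (val e).1) f)@_(val e).2 = 0.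
  rewrite -(a0 e) shift_sum raddf_sum; apply: eq_bigr => M _.
  by rewrite shiftZ [RHS]/= -mcoeffZ.
have hf : band 0 D f by apply: band_poly_of.
apply/negPn/negP => f0.
have /existsP[M1 M1f] : [exists M : 'X_{1..k < D.+1}, (shift (x p0) f)@_M != 0].
  apply: contraNT f0 => /existsPn h; rewrite -(shift_eq0 (x p0)); apply/eqP.
  apply: (@band_eqP _ D); [exact: band_restr|exact: band0|move=> M].
  by rewrite mcoeff0; apply/eqP; rewrite -[_ == _]negbK.
have e0P : (p0 \in Q) && ((shift (x p0) f)@_M1 != 0) by rewrite p0Q.
have [[p M] /= /andP[pQ fpM] pMmin] := @lexmin_exists _
  (fun e : 'I_m * 'X_{1..k < D.+1} => (e.1 \in Q) && ((shift (x e.1) f)@_e.2 != 0))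
  (fun e => lev be e.1 (mdeg e.2)) (fun e => pickle (bmnm e.2)) (p0, M1) e0P.
have pMpiv : M \in pivots D Q be p.
  rewrite inE; apply/asboolP; exists f; split=> //.
    move=> q M' qQ; apply: contraTeq => fM'.
    have /andP[_ dM'] := (@band_restr _ _ _ 1%:M (x q) _ _ hf) M' fM'.
    have := pMmin (q, BMultinom (dM' : (mdeg M' < D.+1)%N)).
    by rewrite /= qQ fM' -leqNgt => /(_ isT)[/ltnW|[-> _]].
  move=> M' dM'; apply: contraTeq => fM'.
  have dM'D : (mdeg M' < D.+1)%N by rewrite dM'; apply: bmdeg.
  have := pMmin (p, BMultinom dM'D); rewrite /= pQ fM' dM' ltnn -leqNgt.
  by case/(_ isT) => // -[].
have pMP : ((p, M).1 \in Q) && ((p, M).2 \in pivots D Q be (p, M).1) by rewrite pQ.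
by have /eqP := a0 (exist _ (p, M) pMP); rewrite /= (negbTE fpM).
Qed.

(** Making the other points earlier only adds to the conditions that precede those at p. *)
Lemma pivots_delay D Q be be' p : (forall q, be' q <= be q)%N -> be' p = be p ->
  (npiv D Q be' p <= npiv D Q be p)%N.
Proof.
move=> le eqp; apply/subset_leq_card/subsetP => M; rewrite !inE => /asboolP[f [h1 h2 h3 h4]].
apply/asboolP; exists f; split => // q M' qQ lt; apply: h3 => //.
apply: leq_ltn_trans (_ : lev be q (mdeg M') < _)%N.
  by rewrite leq_add2r leq_mul2r leq_add2l le orbT.
by move: lt; rewrite /lev eqp.
Qed.

Lemma leq_card_pivots D D' Q Q' be be' p : (D <= D')%N ->
  (forall M, (mdeg M <= D)%N -> pivot D Q be p M -> pivot D' Q' be' p M) ->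
  (npiv D Q be p <= npiv D' Q' be' p)%N.
Proof.
move=> le h; have lt (M : 'X_{1..k < D.+1}) : (mdeg M < D'.+1)%N.
  by apply: leq_trans (bmdeg M) _.
rewrite /npiv -(card_imset _ (f := fun M => BMultinom (lt M))); last first.
  by move=> M M' /(congr1 (@bmnm _ _)) /= e; apply/eqP; rewrite bmeqP e.
apply/subset_leq_card/subsetP => _ /imsetP[M + ->]; rewrite !inE => /asboolP hM.
by apply/asboolP/h => //; apply: (bmdeg M).
Qed.

Lemma npiv_degree D D' Q be p : (D <= D')%N -> (npiv D Q be p <= npiv D' Q be p)%N.
Proof.
move=> le; apply: leq_card_pivots => // M _ [f [h1 h2 h3 h4]]; exists f; split => //.
exact: sub_band h1.
Qed.

(* Multiplying by affine functions vanishing at the other points makes up for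
   one unit of delay, at the cost of raising the degree. *)
Lemma npiv_speed D Q be be' p : p \in Q -> {in Q, forall q, q != p -> x q != x p} ->
  (forall q, q != p -> be' q = be q) -> be p = (be' p).+1 ->
  (npiv D Q be' p <= npiv (D + m) Q be p)%N.
Proof.
move=> pQ xinj beq bep; apply: leq_card_pivots => [|M dM [f [h1 h2 h3 h4]]].
  exact: leq_addr.
pose l q := if [pick i | x q 0 i != x p 0 i] is Some i
  then 'X_i - (x q 0 i)%:MP else 1 : {mpoly F[k]}.
have lq q : q \in Q -> q != p ->
    [/\ band 0 1 (l q), band 1 1 (shift (x q) (l q)) & (shift (x p) (l q))@_0%MM != 0].
  move=> qQ qp; rewrite /l; case: pickP => [i xi|h]; last first.
    by case/negP: (xinj q qQ qp); apply/eqP/rowP => i; have /negbFE/eqP := h i.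
  have shB c : shift c ('X_i - (x q 0 i)%:MP) = 'X_i + (c 0 i - x q 0 i)%:MP.
    by rewrite /shift raddfB /= restr_mpolyC [restr _ _ _]shiftX mpolyCB addrA.
  split.
  - rewrite -mpolyCN; apply: bandD.
      exact: (sub_band _ _ (@bandX _ _ _)).
    exact: (sub_band _ _ (@bandC _ _ _)).
  - by rewrite shB subrr mpolyC0 addr0; apply: bandX.
  - by rewrite shB mcoeffD mcoeffX mcoeffC mnm1_eq0 eqxx mulr1 add0r subr_eq0 eq_sym.
(* [L] vanishes at the points of Q other than [x p], so [f * L] gains one order there. As [L] is
   nonzero at [x p], the lowest part of f at [x p] is only multiplied by a nonzero scalar. *)
pose L := \prod_(q in Q :\ p) l q.
have hL : band 0 m L.
  have hb q : band 0 1 (if q \in Q :\ p then l q else 1).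
    case: ifP => [/setD1P[qp qQ]|_]; first by case: (lq q qQ qp).
    by rewrite -mpolyC1; apply: (sub_band _ _ (@bandC _ _ _)).
  have := @band_prod F k _ (index_enum _) _ (fun=> 0%N) (fun=> 1%N) hb.
  by rewrite big1 // sum1_card card_ord -big_mkcond.
have hLq q : q \in Q -> q != p -> exists b, band 1 b (shift (x q) L).
  move=> qQ qp; rewrite /L (bigD1 q) /= ?inE ?qp // shiftM.
  set L' := \prod_(_ | _) _; exists (1 + msize (shift (x q) L'))%N.
  apply: (@bandM _ _ 1 1 0); first by case: (lq q qQ qp).
  by move=> M'; rewrite -mcoeff_msupp => /msize_mdeg_lt/ltnW.
have hL0 : (shift (x p) L)@_0%MM != 0.
  rewrite /L; elim/big_rec: _ => [|q g /setD1P[qp qQ] g0].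
    by rewrite /shift rmorph1 mcoeff1 eqxx oner_neq0.
  rewrite shiftM (@mcoeffM_low _ 0 (msize (shift (x p) (l q)))) ?mdeg0 //; last first.
    by move=> M'; rewrite -mcoeff_msupp => /msize_mdeg_lt/ltnW.
  by rewrite mulf_neq0 //; case: (lq q qQ qp).
have hp : band (mdeg M) D (shift (x p) f).
  move=> M' fM'; have /andP[_ ->] := @band_restr _ _ _ 1%:M (x p) _ _ h1 _ fM'.
  rewrite andbT leqNgt.
  apply: contraNN fM' => lt; apply/eqP/h3 => //.
  by rewrite /lev ltn_add2r ltn_mul2r (leq_ltn_trans _ (ltn_ord p)) ?ltn_add2r.
exists (f * L); split.
- exact: bandM h1 hL.
- by rewrite shiftM (mcoeffM_low _ hp) ?mulf_neq0.
- move=> q M' qQ lt; have [qp|qp] := eqVneq q p.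
    rewrite qp shiftM (mcoeffM_low _ hp); last first.
      by move: lt; rewrite qp /lev; have := ltn_ord p; nia.
    rewrite -qp h3 ?mul0r // qp; move: lt; rewrite qp /lev; have := ltn_ord p; nia.
  have [b hb] := hLq q qQ qp; rewrite shiftM.
  have hfq : band (mdeg M') D (shift (x q) f).
    move=> M'' fM''; have /andP[_ ->] := @band_restr _ _ _ 1%:M (x q) _ _ h1 _ fM''.
    rewrite andbT leqNgt.
    apply: contraNN fM'' => ltM; apply/eqP/h3 => //; move: lt; rewrite /lev bep (beq _ qp).
    have := ltn_ord p; nia.
  have := bandM hfq hb (m := M'); rewrite addn1.
  by case: eqVneq => // _ /(_ isT); rewrite ltnn.
- move=> M' dM' lt; rewrite shiftM (mcoeffM_low _ hp) ?dM' //.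
  by rewrite h4 ?mul0r.
Qed.

(** By [npiv_speed] it suffices to bound the growth of the count at p when the degree goes from D to
    D + m. The total over Q goes from [nmon k D] to [nmon k (D + m)] and no count drops, so the
    growth at p is at most that of the total. *)
Lemma npiv_lipschitz D Q be be' p : p \in Q ->
  {in Q, forall q, q != p -> x q != x p} ->
  (forall q, q != p -> be' q = be q) -> be p = (be' p).+1 ->
  (npiv D Q be' p + nmon k D <= npiv D Q be p + nmon k (D + m))%N.
Proof.
move=> pQ xinj beq bep.
have h1 := npiv_speed D pQ xinj beq bep.
have h2 := @sum_npiv_ge D Q be p pQ; have h3 := sum_npiv_le (D + m) Q be.
have h4 : (\sum_(q in Q :\ p) npiv D Q be q <= \sum_(q in Q :\ p) npiv (D + m) Q be q)%N.
  by apply: leq_sum => q _; apply: npiv_degree; apply: leq_addr.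
rewrite (big_setD1 p pQ) /= in h2; rewrite (big_setD1 p pQ) /= in h3.
apply: leq_trans (leq_add h1 h2) _; rewrite addnCA leq_add2l.
by apply: leq_trans h3; rewrite leq_add2l.
Qed.

End Points.
End Pivots.

(** * Polynomials seen along one block of variables *)

Section Blocks.
Variables (F : fieldType) (k n : nat) (io : 'I_k -> 'I_n).
Hypothesis io_inj : injective io.

Let slot i := [pick l | io l == i].

Let slot_io l : slot (io l) = Some l.
Proof. by rewrite /slot; case: pickP => [l' /eqP/io_inj -> //|/(_ l)]; rewrite eqxx. Qed.

Let slot_none i : i \notin io @: setT -> slot i = None.
Proof.
move=> h; rewrite /slot; case: pickP => // l /eqP li.
by rewrite -li imset_f ?inE in h.
Qed.

Definition mpart (M : 'X_{1..n}) : 'X_{1..k} := [multinom M (io l) | l < k].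

Definition mglue (M : 'X_{1..n}) (N : 'X_{1..k}) : 'X_{1..n} :=
  [multinom (if slot i is Some l then N l else M i) | i < n].

Definition moff (M : 'X_{1..n}) := mglue M 0%MM.

Definition embed (c : 'rV[F]_k) : 'rV[F]_n :=
  \row_i (if slot i is Some l then c 0 l else 0).

Lemma mpart_glue M N : mpart (mglue M N) = N.
Proof. by apply/mnmP => l; rewrite !mnmE slot_io. Qed.

Lemma moff_glue M N : moff (mglue M N) = moff M.
Proof. by apply/mnmP => i; rewrite !mnmE; case: slot. Qed.

Lemma mglue_out M N i : i \notin io @: setT -> mglue M N i = M i.
Proof. by move=> /slot_none h; rewrite mnmE h. Qed.

Lemma mglue_in M N l : mglue M N (io l) = N l.
Proof. by rewrite mnmE slot_io. Qed.

Lemma mglue_part M : mglue M (mpart M) = M.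
Proof.
apply/mnmP => i; have [/imsetP[l _ ->]|h] := boolP (i \in io @: setT).
  by rewrite mglue_in mnmE.
by rewrite mglue_out.
Qed.

Lemma mpart_off_inj M M' : mpart M = mpart M' -> moff M = moff M' -> M = M'.
Proof.
move=> e1 e2; apply/mnmP => i.
have [/imsetP[l _ ->]|h] := boolP (i \in io @: setT).
  by have /mnmP/(_ l) := e1; rewrite !mnmE.
by have /mnmP/(_ i) := e2; rewrite !mglue_out.
Qed.

Lemma big_block (R : Type) (idx : R) (op : Monoid.com_law idx) (g : 'I_n -> R) :
  \big[op/idx]_i g i =
  op (\big[op/idx]_l g (io l)) (\big[op/idx]_(i | i \notin io @: setT) g i).
Proof.
rewrite (bigID (mem (io @: setT))) /=; congr (op _ _).
by rewrite big_imset /=; [apply: eq_bigl => l; rewrite inE|move=> ? ? _ _; apply: io_inj].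
Qed.

Lemma mdeg_glue M N : mdeg (mglue M N) = (mdeg N + mdeg (moff M))%N.
Proof.
rewrite !mdegE (big_block _ (mglue M N)) (big_block _ (moff M)) /=.
rewrite [X in (_ + (X + _))%N]big1 ?add0n => [|l _]; last by rewrite mglue_in mnm0E.
congr (_ + _)%N; first by apply: eq_bigr => l _; rewrite mglue_in.
by apply: eq_bigr => i h; rewrite !mglue_out.
Qed.

Lemma mdeg_part M : mdeg M = (mdeg (mpart M) + mdeg (moff M))%N.
Proof. by rewrite -mdeg_glue mglue_part. Qed.

Let sep1 (i : 'I_n) : {mpoly {mpoly F[k]}[n]} :=
  if slot i is Some l then ('X_l)%:MP else 'X_i.

(** The variables of the block move into the coefficient ring. The outer ring formally keeps all n
    variables, which avoids reindexing those outside the block. *)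
Definition sep : {mpoly F[n]} -> {mpoly {mpoly F[k]}[n]} :=
  mmap (@mpolyC n {mpoly F[k]} \o @mpolyC k F) sep1.

HB.instance Definition _ := GRing.RMorphism.copy sep
  (mmap (@mpolyC n {mpoly F[k]} \o @mpolyC k F) sep1).

(* The coefficient in h of the monomial moff M of the variables outside the
   block io, as a polynomial in the variables of the block. *)
Definition slice M (h : {mpoly F[n]}) : {mpoly F[k]} := (sep h)@_(moff M).

Let sepX M : sep 'X_[M] = 'X_[mpart M] *: 'X_[moff M].
Proof.
rewrite /sep mmapX /mmap1 big_block /= -mul_mpolyC; congr (_ * _).
  rewrite mpolyXE_id rmorph_prod; apply: eq_bigr => l _.
  by rewrite /sep1 slot_io rmorphXn mnmE.
rewrite mpolyXE_id [RHS]big_block /= [in RHS]big1 ?mul1r => [|l _].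
  by apply: eq_bigr => i h; rewrite /sep1 slot_none // mglue_out.
by rewrite mglue_in mnm0E expr0.
Qed.

Lemma coef_slice M N h : (slice M h)@_N = h@_(mglue M N).
Proof.
rewrite /slice [in LHS](mpolyE h) [in RHS](mpolyE h) (raddf_sum sep) !raddf_sum /=.
apply: eq_bigr => M' _; rewrite !mcoeffZ -mul_mpolyC rmorphM /= sepX.
rewrite {1}/sep mmapC /= !mcoeffCM mcoeffZ !mcoeffX; congr (_ * _).
rewrite -[in RHS](mglue_part M').
have [e|ne] := eqVneq (moff M') (moff M); last first.
  rewrite mulr0 mcoeff0 [_ == _](_ : _ = false) //; apply: contraNF ne => /eqP e.
  by rewrite -(moff_glue M' (mpart M')) e moff_glue.
rewrite mulr1 mcoeffX; congr (nat_of_bool _)%:R; apply/eqP/eqP => [<-|].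
  by apply: mpart_off_inj; rewrite ?mpart_glue ?moff_glue.
by move/(congr1 mpart); rewrite !mpart_glue.
Qed.

Lemma map_shift_sep c h : map_mpoly (restr 1%:M c) (sep h) = sep (shift (embed c) h).
Proof.
apply: (@eq_rmorph_mpoly _ n _ (map_mpoly (restr 1%:M c) \o sep) (sep \o restr 1%:M (embed c))).
  by move=> a /=; rewrite restr_mpolyC /sep mmapC /= map_mpolyC /= restr_mpolyC.
move=> i /=; rewrite [restr _ _ 'X_i]shiftX rmorphD /= /sep mmapC /= mxE !mmapX !mmap1U /sep1.
case: slot => [l|]; first by rewrite map_mpolyC /= [restr _ _ _]shiftX mpolyCD.
by rewrite map_mpolyX mpolyC0 addr0.
Qed.

(** A translation along the block leaves the outer variables alone, so it commutes with taking a
    coefficient in them. *)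
Lemma shift_slice M c h : shift c (slice M h) = slice M (shift (embed c) h).
Proof.
by rewrite /slice -map_shift_sep; symmetry; exact: (mcoeff_map_mpoly (restr 1%:M c)).
Qed.

Lemma embed_mul (c : 'rV[F]_k) (B : 'M[F]_n) (A : 'M[F]_(k, n)) :
  (forall l, row (io l) B = row l A) -> embed c *m B = c *m A.
Proof.
move=> h; apply/rowP => i; rewrite !mxE big_block /= [X in _ + X]big1 ?addr0.
  apply: eq_bigr => l _; rewrite mxE slot_io; congr (_ * _).
  by have /rowP/(_ i) := h l; rewrite !mxE.
by move=> i' h'; rewrite mxE slot_none // mul0r.
Qed.

End Blocks.

Lemma leq_card_prod (Y I : finType) (Z : I -> finType) (f : forall j, Y -> Z j)
    (P : {set Y}) (G : forall j, {set Z j}) :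
  (forall y y', (forall j, f j y = f j y') -> y = y') ->
  (forall y, y \in P -> forall j, f j y \in G j) ->
  (#|P| <= \prod_j #|G j|)%N.
Proof.
move=> finj fG; pose h y : {dffun forall j, Z j} := [ffun j => f j y].
rewrite -(@card_imset _ _ h); last first.
  by move=> y y' /ffunP e; apply: finj => j; have := e j; rewrite !ffunE.
have := @card_family I Z (fun j => [pred z | z \in G j]).
rewrite foldrE big_map big_enum => <-.
apply/subset_leq_card/subsetP => _ /imsetP[y yP ->]; apply/familyP => j.
by rewrite ffunE; apply: fG.
Qed.

(** * The lower bound for the sum of the products of pivot counts *)

Section Vanishing.
Variables (F : fieldType) (m n : nat) (X : 'I_m -> 'rV[F]_n).

(** The equation says that [X q - X p] is recovered from its coordinates. When [C] is the
    pseudo-inverse of [A], it holds exactly for the points of the flat X p + <A>. *)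
Definition onflat k (A : 'M[F]_(k, n)) (C : 'M[F]_(n, k)) p : {set 'I_m} :=
  [set q | (X q - X p) *m C *m A == X q - X p].

(* The matrix C provides coordinates on the flat X p + <A>. *)
Definition bflat D be k (A : 'M[F]_(k, n)) (C : 'M[F]_(n, k)) p :=
  npiv (fun q => X q *m C) D (onflat A C p) be p.

Variables (d : nat) (k : 'I_d -> nat) (io : forall j, 'I_(k j) -> 'I_n).
Hypothesis io_bij : bijective (fun t : {j : 'I_d & 'I_(k j)} => io (tagged t)).

Let io_inj j : injective (@io j).
Proof.
move=> l l' e; have := @bij_inj _ _ _ io_bij (Tagged (fun j => 'I_(k j)) l) (Tagged _ l') e.
by move/eqP; rewrite eq_Tagged => /eqP.
Qed.

Let io_disj j j' l : j != j' -> @io j l \notin @io j' @: setT.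
Proof.
apply: contra => /imsetP[l' _ e].
have := @bij_inj _ _ _ io_bij (Tagged (fun j => 'I_(k j)) l) (Tagged (fun j => 'I_(k j)) l') e.
by move/(congr1 tag) => /= ->.
Qed.

Let mpart_inj (M M' : 'X_{1..n}) :
  (forall j, mpart (@io j) M = mpart (@io j) M') -> M = M'.
Proof.
move=> h; apply/mnmP => i; have [g _ gK] := io_bij.
rewrite -(gK i); case: (g i) => j l /=.
by have /mnmP/(_ l) := h j; rewrite !mnmE.
Qed.

(** A nonzero polynomial of degree at most D has, at some p in S and in the coordinates [B p], a
    nonzero coefficient at a monomial whose part in every block is a pivot of the corresponding
    flat. So these coefficients determine the polynomial, and at each p there are at most as many as
    the product of the pivot counts. *)
Lemma vanishing D be (S : {set 'I_m}) p0 (A : 'I_m -> forall j, 'M[F]_(k j, n))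
    (C : 'I_m -> forall j, 'M[F]_(n, k j)) (B : 'I_m -> 'M[F]_n) :
  p0 \in S ->
  (forall p q, p \in S -> q \notin S -> (be p + D < be q)%N) ->
  (forall p j l, row (@io j l) (B p) = row l (A p j)) ->
  (forall p, p \in S -> B p \in unitmx) ->
  (nmon n D <= \sum_(p in S) \prod_(j < d) bflat D be (A p j) (C p j) p)%N.
Proof.
move=> p0S gap rowB Bu.
have pbP j (M : 'X_{1..n < D.+1}) : (mdeg (mpart (@io j) M) < D.+1)%N.
  apply: leq_ltn_trans (bmdeg M); rewrite [leqRHS](mdeg_part (@io_inj j)).
  exact: leq_addr.
pose pb j M := BMultinom (pbP j M).
pose piv p j := pivots (fun q => X q *m C p j) D (onflat (A p j) (C p j) p) be p.
pose T := {e : 'I_m * 'X_{1..n < D.+1} |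
  (e.1 \in S) && (e.2 \in [set M | [forall j, pb j M \in piv e.1 j]])}.
have cT : (#|{: T}| <= \sum_(p in S) \prod_(j < d) bflat D be (A p j) (C p j) p)%N.
  rewrite card_sig -sum1_card.
  rewrite -(@pair_big_dep _ _ _ _ _ (mem S)
    (fun p M => M \in [set M | [forall j, pb j M \in piv p j]]) (fun _ _ => 1%N)) /=.
  apply: leq_sum => p _; rewrite sum1_card; apply: (leq_card_prod (f := pb)).
    move=> M M' h; apply/eqP; rewrite bmeqP; apply/eqP/mpart_inj => j.
    exact: (congr1 (@bmnm _ _) (h j)).
  by move=> M; rewrite inE => /forallP.
apply: leq_trans cT; apply: (@leq_card_linear F _ _
  (fun (M : 'X_{1..n < D.+1}) (e : T) => (restr (B (val e).1) (X (val e).1) 'X_[M])@_(val e).2)).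
move=> a a0 M0; rewrite -[LHS]coef_poly_of; set f := poly_of a.
suff /eqP -> : f == 0 by rewrite mcoeff0.
have {}a0 (e : T) : (restr (B (val e).1) (X (val e).1) f)@_(val e).2 = 0.
  rewrite -(a0 e) /f /poly_of restr_sum raddf_sum; apply: eq_bigr => M _.
  by rewrite restrZ [RHS]/= -mcoeffZ.
have hf : band 0 D f by apply: band_poly_of.
apply/negPn/negP => f0.
have nz p : exists M : 'X_{1..n < D.+1}, (shift (X p) f)@_M != 0.
  apply/existsP; apply: contraNT f0 => /existsPn h; rewrite -(shift_eq0 (X p)); apply/eqP.
  apply: (@band_eqP _ _ D); [exact: band_restr|exact: band0|move=> M].
  by rewrite mcoeff0; apply/eqP; rewrite -[_ == _]negbK.
have [M1 M1f] := nz p0.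
have e0P : (p0 \in S) && ((shift (X p0) f)@_M1 != 0) by rewrite p0S.
(* The secondary key is constant, since only the point and the order matter here; the monomial is
   chosen later, in the coordinates [B p]. *)
have [[p M2] /= /andP[pS M2f] pmin] := @lexmin_exists _
  (fun e : 'I_m * 'X_{1..n < D.+1} => (e.1 \in S) && ((shift (X e.1) f)@_e.2 != 0))
  (fun e => lev be e.1 (mdeg e.2)) (fun=> 0%N) (p0, M1) e0P.
set r := mdeg M2 in pmin.
have low q t : q \in S ->
    (forall s, (s < t)%N -> (lev be q s < lev be p r)%N) -> band t D (shift (X q) f).
  move=> qS hlt M' nM'.
  have /andP[_ dM'] := @band_restr _ _ _ 1%:M (X q) _ _ hf _ nM'.
  rewrite dM' andbT leqNgt; apply/negP => /hlt; rewrite ltnNge => /negP; apply.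
  have := pmin (q, BMultinom (dM' : (mdeg M' < D.+1)%N)); rewrite /= qS nM'.
  by case/(_ isT) => [/ltnW|[-> _]].
have lowp : band r D (shift (X p) f).
  apply: low => // s sr; rewrite /lev.
  by rewrite ltn_add2r ltn_mul2r ltn_add2r sr (leq_ltn_trans _ (ltn_ord p)).
have restrE q : restr (B p) (X q) f = restr (B p) 0 (shift (X q) f).
  by rewrite /shift restr_comp mulmx1 mul0mx addr0.
(* Otherwise f would have order greater than r in the coordinates [B p], hence also after undoing
   [B p], against [M2f]. *)
have [M3 M3f] : exists M : 'X_{1..n < D.+1}, (mdeg M == r) && ((restr (B p) (X p) f)@_M != 0).
  apply/existsP; apply: contraT => /existsPn h.
  have hB : band r.+1 D (restr (B p) (X p) f).
    move=> M nM; have := @band_linear _ _ _ (B p) _ _ _ lowp.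
    rewrite -restrE => /(_ M nM)/andP[rM MD]; rewrite MD andbT ltn_neqAle rM andbT eq_sym.
    by have := h (BMultinom (MD : (mdeg M < D.+1)%N)); rewrite /= nM andbT.
  have := @band_linear _ _ _ (invmx (B p)) _ _ _ hB; rewrite restrE restr_comp mulVmx ?Bu //.
  by rewrite mul0mx addr0 restr_id => /(_ _ M2f); rewrite ltnn.
(* Minimizing the sum of the codes makes each block part of M first among its replacements of the
   same degree, for all blocks at once. *)
have [M /andP[/eqP Mr Mf] Mmin] := arg_minnP
  (P := fun M : 'X_{1..n < D.+1} => (mdeg M == r) && ((restr (B p) (X p) f)@_M != 0))
  (fun M => (\sum_j pickle (mpart (@io j) M))%N) M3f.
suff MT : (p \in S) && (M \in [set M | [forall j, pb j M \in piv p j]]).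
  by have /eqP := a0 (exist _ (p, M) MT); rewrite /= (negbTE Mf).
rewrite pS inE; apply/forallP => j; rewrite inE; apply/asboolP.
pose x q := X q *m C p j; set N := bmnm (pb j M).
(* The witness is the coefficient of [moff M] in f, a polynomial on the j-th flat through [X p],
   recentred so that [x q] are the coordinates of the point q. *)
pose g := shift (- x p) (slice (@io j) M (restr (B p) (X p) f)).
have gE q M' : q \in onflat (A p j) (C p j) p ->
    (shift (x q) g)@_M' = (restr (B p) (X q) f)@_(mglue (@io j) M M').
  rewrite inE => /eqP qp; rewrite /g shift_shift (shift_slice (@io j)) (coef_slice (@io_inj j)).
  congr (_@__); rewrite /shift restr_comp mul1mx (embed_mul (@io_inj j) _ (rowB p j)).
  by rewrite [- x p + _]addrC -mulmxBl qp subrKC.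
have ponflat : p \in onflat (A p j) (C p j) p by rewrite inE subrr !mul0mx.
have degM : mdeg M = (mdeg N + mdeg (moff (@io j) M))%N by apply: mdeg_part.
have NE : mglue (@io j) M N = M by exact: (mglue_part (@io_inj j) M).
have gpN : (shift (x p) g)@_N != 0 by rewrite (gE p N ponflat) NE.
exists g; split.
- apply: band_restr => M' nM'; move: nM'; rewrite (coef_slice (@io_inj j)).
  move=> /(band_restr hf) /=; rewrite (mdeg_glue (@io_inj j)).
  by apply: leq_trans; apply: leq_addr.
- exact: gpN.
- move=> q M' qp lt; rewrite gE //.
  (* By the gap, any condition at a point outside S comes after those of order at most D at p. *)
  have qS : q \in S.
    apply: contraTT lt => /(gap p q pS) lt; rewrite -leqNgt; apply: lev_le.
    apply: leq_trans (leq_addl _ _); apply: leq_ltn_trans lt.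
    by rewrite addnC leq_add2l; apply: (bmdeg (pb j M)).
  set t := mdeg (mglue (@io j) M M').
  have tE : t = (mdeg M' + mdeg (moff (@io j) M))%N by apply: mdeg_glue.
  (* Passing from the flat to the whole space raises both orders by the degree of [moff M], which
     preserves the comparison of levels. *)
  have ltr s : (s < t.+1)%N -> (lev be q s < lev be p r)%N.
    rewrite ltnS => /(leq_lev be q)/leq_ltn_trans; apply.
    by rewrite -Mr degM tE !levD ltn_add2r.
  have := @band_linear _ _ _ (B p) _ _ _ (low q t.+1 qS ltr).
  rewrite -restrE => /(_ (mglue (@io j) M M')).
  by rewrite ltnn; case: eqVneq => // _ /(_ isT).
- move=> M' dM' lt; rewrite gE //; apply/eqP/negPn/negP => nM'.
  have dg : mdeg (mglue (@io j) M M') = r by rewrite (mdeg_glue (@io_inj j)) dM' -degM.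
  have dgD : (mdeg (mglue (@io j) M M') < D.+1)%N by rewrite dg bmdeg.
  have := Mmin (BMultinom dgD); rewrite /= dg eqxx nM' => /(_ isT).
  rewrite leqNgt => /negP; apply; rewrite (bigD1 j) // [ltnRHS](bigD1 j) //=.
  rewrite mpart_glue //.
  rewrite (eq_bigr (fun j' => pickle (mpart (@io j') M))) ?ltn_add2r // => j' j'j.
  congr pickle; apply/mnmP => l; rewrite [LHS]mnmE [RHS]mnmE.
  by apply: mglue_out; apply: io_disj.
Qed.

End Vanishing.

Lemma nmonE k D : nmon k D = 'C(k + D, k).
Proof.
rewrite -card_partial_ord_partitions /nmon.
pose f (M : 'X_{1..k < D.+1}) : k.-tuple 'I_D.+1 := [tuple inord (M i) | i < k].
have Mle (M : 'X_{1..k < D.+1}) i : (M i <= D)%N.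
  by apply: leq_trans (_ : mdeg M <= D)%N; [rewrite mdegE (bigD1 i) //= leq_addr|apply: (bmdeg M)].
have fE M i : tnth (f M) i = M i :> nat by rewrite tnth_mktuple inordK ?ltnS.
rewrite -(card_imset predT (f := f)); last first.
  by move=> M M' e; apply/eqP; rewrite bmeqP; apply/eqP/mnmP => i; rewrite -!fE e.
apply: eq_card => t; rewrite inE big_tuple; apply/imsetP/idP => [[M _ ->]|le].
  under eq_bigr => i _ do rewrite fE.
  by rewrite -mdegE; apply: (bmdeg M).
pose M := [multinom (tnth t i : nat) | i < k].
have dM : (mdeg M < D.+1)%N.
  by rewrite ltnS mdegE; under eq_bigr => i _ do rewrite mnmE.
exists (BMultinom dM) => //; apply: eq_from_tnth => i; apply: val_inj.
by rewrite /= fE /= mnmE.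
Qed.

(** * Pivot counts on a single flat *)

Section Flats.
Variables (F : fieldType) (m n : nat) (X : 'I_m -> 'rV[F]_n).
Variables (k : nat) (A : 'M[F]_(k, n)) (C : 'M[F]_(n, k)).

Lemma mem_onflat p : p \in onflat X A C p.
Proof. by rewrite inE subrr !mul0mx. Qed.

Lemma eq_onflat p q : q \in onflat X A C p -> onflat X A C q = onflat X A C p.
Proof.
rewrite inE => /eqP qp; apply/setP => r; rewrite !inE.
have -> : X r - X p = (X r - X q) + (X q - X p) by rewrite addrA subrK.
by move: (X q - X p) qp (X r - X q) => v ve u; rewrite !mulmxDl ve (inj_eq (addIr _)).
Qed.

Lemma sum_bflat_le D be p : (\sum_(q in onflat X A C p) bflat X D be A C q <= nmon k D)%N.
Proof.
rewrite (eq_bigr (fun q => npiv (fun q => X q *m C) D (onflat X A C p) be q)).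
  exact: sum_npiv_le.
by move=> q qp; rewrite /bflat (eq_onflat qp).
Qed.

Lemma bflat_le D be p : (bflat X D be A C p <= nmon k D)%N.
Proof.
apply: leq_trans (sum_bflat_le D be p).
by rewrite (bigD1 p (mem_onflat p)) leq_addr.
Qed.

Lemma bflat_delay D be be' p : (forall q, be' q <= be q)%N -> be' p = be p ->
  (bflat X D be' A C p <= bflat X D be A C p)%N.
Proof. exact: pivots_delay. Qed.

Lemma bflat_lipschitz D be be' p : injective X ->
  (forall q, q != p -> be' q = be q) -> be p = (be' p).+1 ->
  (bflat X D be' A C p + nmon k D <= bflat X D be A C p + nmon k (D + m))%N.
Proof.
move=> Xinj; apply: npiv_lipschitz; first exact: mem_onflat.
move=> q; rewrite inE => /eqP e; apply: contra => /eqP XC.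
by rewrite -(inj_eq Xinj) -subr_eq0 -e mulmxBl XC subrr mul0mx.
Qed.

End Flats.

End Multinomials.

Require Import Defs.
From mathcomp Require Import all_classical all_reals all_analysis.

(** * Binomial estimates and the choice of the degree *)

Section Counting.

Lemma bin_step k D : (k.+1 * 'C(k.+1 + D, k.+1) = (k.+1 + D) * 'C(k + D, k))%N.
Proof. by rewrite -mul_bin_diag. Qed.

Lemma bin_le_exp k D : ('C(k + D, k) <= D.+1 ^ k)%N.
Proof.
elim: k => [|k IH]; first by rewrite bin0.
rewrite -(leq_pmul2l (ltn0Sn k)) bin_step expnS mulnA leq_mul //; nia.
Qed.

Lemma exp_le_bin k D : (D.+1 ^ k <= k`! * 'C(k + D, k))%N.
Proof.
elim: k => [|k IH]; first by rewrite bin0.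
rewrite factS -mulnA mulnCA bin_step mulnCA expnS leq_mul //.
by rewrite addSn ltnS leq_addl.
Qed.

(** The ratio of the two binomials is the product of the factors 1 + m / (D + i), 1 <= i <= k, each
    at most 1 + m / (D + 1). *)
Lemma bin_degree k D m :
  ('C(k + (D + m), k) * D.+1 ^ k <= (D.+1 + m) ^ k * 'C(k + D, k))%N.
Proof.
elim: k => [|k IH]; first by rewrite !bin0.
rewrite -(leq_pmul2l (ltn0Sn k)) mulnA bin_step [leqRHS]mulnCA bin_step !expnS.
have -> : ((k.+1 + (D + m)) * 'C(k + (D + m), k) * (D.+1 * D.+1 ^ k) =
  ((k.+1 + (D + m)) * D.+1) * ('C(k + (D + m), k) * D.+1 ^ k))%N by ring.
have -> : ((D.+1 + m) * (D.+1 + m) ^ k * ((k.+1 + D) * 'C(k + D, k)) =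
  ((D.+1 + m) * (k.+1 + D)) * ((D.+1 + m) ^ k * 'C(k + D, k)))%N by ring.
by apply: leq_mul IH; nia.
Qed.

(** Expanded, the increase of a product when the factors grow by [e i] has nonnegative coefficients,
    so it is monotone in the factors. *)
Lemma prod_add_le (I : Type) (r : seq I) (a b e : I -> nat) :
  (forall i, a i <= b i)%N ->
  (\prod_(i <- r) (a i + e i) + \prod_(i <- r) b i <=
   \prod_(i <- r) a i + \prod_(i <- r) (b i + e i))%N.
Proof.
move=> ab; elim: r => [|i r IH]; first by rewrite !big_nil.
rewrite !big_cons.
have h1 : (\prod_(i <- r) (a i + e i) <= \prod_(i <- r) (b i + e i))%N.
  by apply: leq_prod => l _; rewrite leq_add2r.
have QQ' : (\prod_(i <- r) b i <= \prod_(i <- r) (b i + e i))%N.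
  by apply: leq_prod => l _; rewrite leq_addr.
move: IH h1 QQ' (ab i).
move: (\prod_(i <- r) (a i + e i))%N (\prod_(i <- r) (b i + e i))%N => P' Q'.
move: (\prod_(i <- r) a i)%N (\prod_(i <- r) b i)%N (a i) (b i) (e i) => P Q x y z h1 h2 QQ' h3.
have h4 := leq_mul h3 h1; have h5 := leq_mul (leqnn z) h2.
have : (x * P' + x * Q <= x * P + x * Q')%N by rewrite -!mulnDr leq_mul.
have [u uE] : exists u, (y = x + u)%N by exists (y - x)%N; rewrite subnKC.
have [v vE] : exists v, (P + Q' = P' + Q + v)%N by exists (P + Q' - (P' + Q))%N; rewrite subnKC.
have h6 : (u * Q <= u * Q')%N by rewrite leq_mul.
rewrite uE !mulnDl; lia.
Qed.

Lemma exprD1_le (R : realFieldType) (x : R) n : 0 <= x -> x <= 1 ->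
  (1 + x) ^+ n <= 1 + 3 ^+ n * x.
Proof.
move=> x0 x1; elim: n => [|n IH]; first by rewrite !expr0; lra.
rewrite exprS; apply: le_trans (ler_wpM2l _ IH) _; first lra.
rewrite exprS; have : 1 <= 3 ^+ n :> R by rewrite exprn_ege1 // ler1n.
move: (3 ^+ n) => t t1.
have h1 : 0 <= x * (t - 1) by rewrite mulr_ge0 // subr_ge0.
have h2 : 0 <= t * (x * (1 - x)).
  by rewrite !mulr_ge0 ?subr_ge0 //; apply: le_trans t1.
nra.
Qed.

(** Raising the degree by m changes the product by a relative O(m / D), and the product is at most
    n! times 'C(n + D, n), so every large D will do. This bounds the cost of lowering a delay by
    1. *)
Lemma degree_exists (R : realType) n d (k : 'I_d -> nat) m (w : R) :
  (\sum_j k j)%N = n -> 0 < w -> w <= 1 ->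
  exists D, ((\prod_j 'C(k j + (D + m), k j))%:R <=
    (\prod_j 'C(k j + D, k j))%:R + w / 2 * 'C(n + D, n)%:R :> R)%R.
Proof.
(* The factor 3^n comes from [exprD1_le], n! from [h2], and 2 from the bound w / 2. *)
move=> kn w0 w1; pose c : R := 2 * n`!%:R * 3 ^+ n.
have c0 : 2 <= c.
  rewrite /c -mulrA ler_peMr //; apply: mulr_ege1; last by rewrite exprn_ege1 // ler1n.
  by rewrite ler1n fact_gt0.
have [D hD] : exists D : nat, m%:R * c / w <= D.+1%:R.
  exists (Num.bound (m%:R * c / w)); apply: le_trans (ltW (archi_boundP _)) _.
    by rewrite divr_ge0 ?mulr_ge0 ?(ltW w0) //; lra.
  by rewrite ler_nat.
exists D; pose x : R := m%:R / D.+1%:R.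
have D0 : 0 < D.+1%:R :> R by rewrite ltr0n.
have x0 : 0 <= x by rewrite divr_ge0.
have xc : x * c <= w.
  by rewrite /x mulrAC ler_pdivrMr // [w * _]mulrC -ler_pdivrMr.
have x1 : x <= 1 by nra.
set P := (\prod_j 'C(k j + D, k j))%N; set P' := (\prod_j 'C(k j + (D + m), k j))%N.
have h1 : (P' * D.+1 ^ n <= (D.+1 + m) ^ n * P)%N.
  rewrite -kn !expn_sum -!big_split /=; apply: leq_prod => j _; exact: bin_degree.
have h2 : (P <= n`! * 'C(n + D, n))%N.
  apply: leq_trans (exp_le_bin n D); rewrite -kn expn_sum.
  by apply: leq_prod => j _; apply: bin_le_exp.
have h3 : P'%:R <= (1 + x) ^+ n * P%:R :> R.
  have -> : 1 + x = (D.+1 + m)%:R / D.+1%:R.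
    by rewrite natrD mulrDl divff ?gt_eqF.
  rewrite expr_div_n mulrAC ler_pdivlMr ?exprn_gt0 //.
  by rewrite -!natrX -!natrM ler_nat.
have h4 := exprD1_le n x0 x1.
have h5 : P%:R <= n`!%:R * 'C(n + D, n)%:R :> R by rewrite -natrM ler_nat.
have P0 : 0 <= P%:R :> R by [].
have t0 : 0 <= 3 ^+ n * x :> R by rewrite mulr_ge0 ?exprn_ge0.
apply: le_trans h3 _; apply: le_trans (ler_wpM2r P0 h4) _.
rewrite mulrDl mul1r lerD2l; apply: le_trans (ler_wpM2l t0 h5) _.
rewrite mulrA; apply: ler_wpM2r => //.
rewrite ler_pdivlMr //; apply: le_trans xc; rewrite /c le_eqVlt; apply/orP; left; apply/eqP; ring.
Qed.

End Counting.

(** * Balancing the delays *)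

Section Auction.
Variables (R : realType) (F : fieldType) (m n d : nat) (k : 'I_d -> nat).
Hypothesis kn : (\sum_j k j)%N = n.
Variable io : forall j, 'I_(k j) -> 'I_n.
Hypothesis io_bij : bijective (fun t : {j : 'I_d & 'I_(k j)} => io (tagged t)).
Variables (X : 'I_m -> 'rV[F]_n) (w : 'I_m -> R).
Hypotheses (Xinj : injective X) (w0 : forall p, 0 <= w p) (w1 : \sum_p w p <= 1).

(** The matrix form of transversality: the rows of the [A j], placed according to [io], form a
    basis. *)
Definition frame (A : forall j, 'M[F]_(k j, n)) :=
  exists2 B : 'M[F]_n, B \in unitmx & forall j l, row (io l) B = row l (A j).

Let bprod D be (A : forall j, 'M[F]_(k j, n)) (C : forall j, 'M[F]_(n, k j)) p :=
  (\prod_(j < d) bflat X D be (A j) (C j) p)%N.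

Let wle1 p : w p <= 1.
Proof. by apply: le_trans w1; rewrite (bigD1 p) //= lerDl sumr_ge0. Qed.

Let degree_uniform : exists D, forall p, 0 < w p ->
  ((\prod_j 'C(k j + (D + m), k j))%:R <=
    (\prod_j 'C(k j + D, k j))%:R + w p / 2 * 'C(n + D, n)%:R :> R).
Proof.
(* As no weight exceeds 1, the product of the positive weights is a positive lower bound for each of
   them, and one degree serves all points. *)
pose v p := if 0 < w p then w p else 1.
have v0 p : 0 < v p by rewrite /v; case: ifP.
have v1 p : v p <= 1 by rewrite /v; case: ifP.
have V0 : 0 < \prod_p v p by apply: prodr_gt0.
have V1 (P : pred 'I_m) : \prod_(p | P p) v p <= 1.
  by rewrite prodr_ile1 // => p _; rewrite ltW //=.
have [D hD] := degree_exists m kn V0 (V1 predT).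
exists D => p wp; apply: le_trans hD _; rewrite lerD2l ler_wpM2r // ler_wpM2r //.
rewrite (bigD1 p) //= {1}/v wp ler_piMr //.
Qed.

(* If some delay is 0, the delays below K take at most m distinct values, so
   they leave a gap of length D below K. *)
Let gap_exists (be : 'I_m -> nat) D p0 : be p0 = 0%N ->
  exists S : {set 'I_m}, [/\ p0 \in S,
    forall q, q \in S -> (be q < m.+1 * D.+1)%N &
    forall p q, p \in S -> q \notin S -> (be p + D < be q)%N].
Proof.
move=> be0; pose S t := [set q | (be q < t * D.+1)%N].
have [/existsP[t tS]|/existsPn h] := boolP [exists t : 'I_m.+1, (0 < t)%N && (S t.+1 \subset S t)].
  have /andP[t0 /fintype.subsetP st] := tS; exists (S t); split => [|q|p q].
  - by rewrite inE be0 muln_gt0 t0.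
  - by rewrite inE => /leq_trans; apply; rewrite leq_mul2r ltnW ?orbT.
  rewrite inE => pS qS; have : q \notin S t.+1 by apply: contra qS; apply: st.
  by rewrite inE -leqNgt mulSn; lia.
(* Without a gap the sets [S 1], ..., [S m.+1] would grow strictly, too many times for m points. *)
have cS t : (t <= m)%N -> (t < #|S t.+1|)%N.
  elim: t => [|t IH] tm.
    by rewrite card_gt0; apply/set0Pn; exists p0; rewrite inE be0 mul1n.
  have := h (Ordinal (tm : t.+1 < m.+1)%N); rewrite /= => ns.
  apply: leq_ltn_trans (IH (ltnW tm)) _; apply: proper_card; rewrite properE ns andbT.
  by apply/fintype.subsetP => q; rewrite !inE => /leq_trans; apply; rewrite leq_mul2r leqnSn orbT.
by have := leq_trans (cS m (leqnn m)) (max_card _); rewrite card_ord ltnn.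
Qed.

(** Rather than running the process, the proof takes delays of least total among those satisfying
    the invariant [inv]: a point violating the bound would allow a further decrease. *)
Lemma balanced_delays : exists D be, forall p (A : forall j, 'M[F]_(k j, n))
    (C : forall j, 'M[F]_(n, k j)), frame A ->
  w p / 2 * 'C(n + D, n)%:R <= (\prod_(j < d) bflat X D be (A j) (C j) p)%:R :> R.
Proof.
have [D hD] := degree_uniform; pose K := (m.+1 * D.+1)%N.
have T0 : 0 < 'C(n + D, n)%:R :> R by rewrite ltr0n bin_gt0 leq_addr.
(* Only points that have left the initial delay K are constrained, so constant delays K satisfy
   this. *)
pose inv be := forall p, (be p < K)%N ->
  exists A C, frame A /\ (bprod D be A C p)%:R < w p * 'C(n + D, n)%:R :> R.
have ex : exists s, `[< exists2 be, inv be & (\sum_p be p)%N = s >].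
  exists (\sum_(p < m) K)%N; apply/asboolP; exists (fun=> K) => // p.
  by rewrite ltnn.
case: (ex_minnP ex) => s /asboolP[be ibe bes] smin.
exists D, be => p A C fA; rewrite leNgt; apply/negP => lt.
have wp : 0 < w p.
  rewrite lt_neqAle w0 andbT eq_sym; apply: contraTneq lt => ->.
  by rewrite !mul0r -leNgt.
case bep : (be p) => [|b].
  (* The delay of p cannot be lowered, but then all points of S are below K, so the invariant makes
     their products too small for [vanishing], the weights having sum at most 1. *)
  have [S [pS SK gap]] := gap_exists D bep.
  have /choice[f fP] q :
      exists f : (forall j, 'M[F]_(k j, n)) * (forall j, 'M[F]_(n, k j)) * 'M[F]_n,
      [/\ f.2 \in unitmx, forall j l, row (io l) f.2 = row l (f.1.1 j) &
        q \in S -> (bprod D be f.1.1 f.1.2 q)%:R < w q * 'C(n + D, n)%:R :> R].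
    have [qS|qS] := boolP (q \in S).
      by have [A' [C' [[B' ? ?] ?]]] := ibe q (SK q qS); exists (A', C', B').
    by case: fA => B ? ?; exists (A, C, B).
  have rowB q j l : row (io l) (f q).2 = row l ((f q).1.1 j) by case: (fP q).
  have uB q : q \in S -> (f q).2 \in unitmx by case: (fP q).
  have := @vanishing F m n X d k io io_bij D be S p (fun q => (f q).1.1)
    (fun q => (f q).1.2) (fun q => (f q).2) pS gap rowB uB.
  rewrite nmonE.
  apply/negP; rewrite -ltnNge -(ltr_nat R) natr_sum.
  apply: lt_le_trans (_ : \sum_(q in S) w q * 'C(n + D, n)%:R <= _).
    rewrite (bigD1 p) //= [ltRHS](bigD1 p) //=; apply: ltr_leD.
      by case: (fP p) => _ _; apply.
    by apply: ler_sum => q /andP[qS _]; case: (fP q) => _ _ /(_ qS)/ltW.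
  rewrite -mulr_suml ler_piMl ?(ltW T0) //; apply: le_trans w1.
  by rewrite [leRHS](bigID (mem S)) /= lerDl sumr_ge0.
pose be' q := if q == p then b else be q.
have be'le q : (be' q <= be q)%N by rewrite /be'; case: eqP => // ->; rewrite bep.
have be'E q : q != p -> be' q = be q by rewrite /be' => /negbTE ->.
have be'p : be p = (be' p).+1 by rewrite /be' eqxx.
(* The products at the other points do not increase. At p the product was below half of the
   threshold, and the choice of D limits its increase to the other half. *)
have ibe' : inv be'.
  move=> q qK; have [->|qp] := eqVneq q p; last first.
    rewrite be'E // in qK; have [A' [C' [fA' h]]] := ibe q qK.
    exists A', C'; split => //; apply: le_lt_trans h; rewrite ler_nat.
    by apply: leq_prod => j _; apply: bflat_delay => //; apply: be'E.
  exists A, C; split => //.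
  pose e j := ('C(k j + (D + m), k j) - 'C(k j + D, k j))%N.
  have eE j : ('C(k j + D, k j) + e j = 'C(k j + (D + m), k j))%N.
    by rewrite subnKC // leq_bin2l // addnA leq_addr.
  have h1 : (bprod D be' A C p <= \prod_j (bflat X D be (A j) (C j) p + e j))%N.
    apply: leq_prod => j _.
    have := bflat_lipschitz (A j) (C j) D Xinj be'E be'p; rewrite !nmonE -(eE j); lia.
  have h2 : (\prod_j (bflat X D be (A j) (C j) p + e j) + \prod_j 'C(k j + D, k j) <=
      bprod D be A C p + \prod_j 'C(k j + (D + m), k j))%N.
    rewrite [X in (_ <= _ + X)%N](eq_bigr _ (fun j _ => esym (eE j))).
    by apply: prod_add_le => j; rewrite -nmonE; apply: bflat_le.
  have := hD p wp; have {}h2 := leq_trans (leq_add h1 (leqnn _)) h2.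
  move: h2; rewrite -(ler_nat R) !natrD => h2 h3; lra.
have : (\sum_q be' q < s)%N.
  rewrite -bes (bigD1 p) //= [ltnRHS](bigD1 p) //= be'p.
  by rewrite (eq_bigr _ be'E) ltn_add2r.
by rewrite ltnNge => /negP; apply; apply: smin; apply/asboolP; exists be'.
Qed.

End Auction.

(** * From subspaces to matrices *)

Section Frames.
Variables (F : fieldType) (n : nat).

Definition gr_mx k (V : Gr F n k) : 'M[F]_(k, n) := \matrix_(i < k) (vbasis (val V))`_i.

Lemma gr_mxP k (V : Gr F n k) v : v \in val V -> (v <= gr_mx V)%MS.
Proof.
move=> /coord_vbasis ->; apply: summx_sub => i _; apply: scalemx_sub.
have ik : (i < k)%N by apply: leq_trans (ltn_ord i) _; rewrite leq_eqVlt (valP V).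
by have := row_sub (Ordinal ik) (gr_mx V); rewrite rowK.
Qed.

Lemma block_bij d (k : 'I_d -> nat) : (\sum_j k j)%N = n ->
  exists io : forall j, 'I_(k j) -> 'I_n,
    bijective (fun t : {j : 'I_d & 'I_(k j)} => io _ (tagged t)).
Proof.
move=> kn; have e : #|{: {j : 'I_d & 'I_(k j)}}| = n.
  rewrite card_tagged sumnE big_map big_enum /= -kn.
  by apply: eq_bigr => j _; rewrite card_ord.
exists (fun j l => cast_ord e (enum_rank (Tagged (fun j => 'I_(k j)) l))).
apply: (@Bijective _ _ _ (fun i => enum_val (cast_ord (esym e) i))) => [[j l]|i] /=.
  by rewrite cast_ordK enum_rankK.
by case: (enum_val _) (enum_valK (cast_ord (esym e) i)) => j l /= ->; rewrite cast_ordKV.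
Qed.

Lemma frame_gr_mx d (k : 'I_d -> nat) (io : forall j, 'I_(k j) -> 'I_n)
    (V : forall j, Gr F n (k j)) :
  bijective (fun t : {j : 'I_d & 'I_(k j)} => io _ (tagged t)) ->
  wedge V = 1%N -> frame io (fun j => gr_mx (V j)).
Proof.
move=> [g gK Kg]; rewrite /wedge; case: eqP => // Vfull _.
pose B : 'M[F]_n := \matrix_i row (tagged (g i)) (gr_mx (V (tag (g i)))).
have rowB j l : row (io j l) B = row l (gr_mx (V j)).
  by rewrite rowK; have := gK (Tagged (fun j => 'I_(k j)) l) => /= ->.
exists B => //; rewrite -row_full_unit -sub1mx; apply/row_subP => i.
have /memv_sumP[v vV ->] : row i 1%:M \in (\sum_(j < d) val (V j))%VS by rewrite Vfull memvf.
apply: summx_sub => j _; apply: submx_trans (gr_mxP (vV j isT)) _.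
by apply/row_subP => l; rewrite -rowB row_sub.
Qed.

End Frames.

Local Open Scope classical_set_scope.
Local Open Scope ring_scope.

(** * Construction of the weights *)

Lemma translate_eq (F : fieldType) (n k : nat) (V : Gr F n k) p q :
  translate p V q -> translate q V = translate p V.
Proof.
move=> [u /= uV <-]; apply/seteqP; split=> _ [v /= vV <-].
  by exists (u + v); rewrite /= ?memvD // addrA.
by exists (v - u); rewrite /= ?memvB // addrA [p + u + v]addrAC addrK.
Qed.

Lemma esum_point (R : realType) (T : choiceType) (A : set T) a (c : R) : 0 <= c ->
  (\esum_(p in A) (if p == a then c else 0)%:E)%E = (if a \in A then c else 0)%:E.
Proof.
move=> c0; have [aA|aA] := boolP (a \in A); last first.
  rewrite esum1 // => p pA; case: eqP => // pa.
  by move: aA; rewrite -pa mem_set.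
transitivity (\esum_(p in [set a]) (if p == a then c else 0)%:E)%E; last first.
  by rewrite esum_set1 eqxx // lee_fin.
rewrite esum_mkcond [RHS]esum_mkcond; apply: eq_esum => p _.
rewrite in_set1; have [->|pa] := eqVneq p a; first by rewrite aA.
by case: ifP.
Qed.

Lemma norm_d_eq1 (R : realType) (T : choiceType) (J : set T) d (S : T -> R) :
  (0 < d)%N -> (forall p, J p -> 0 <= S p) ->
  finite_set [set p | J p /\ S p != 0] -> norm_d J d S = 1 ->
  exists s : seq T, [/\ uniq s, forall p, p \in s <-> J p /\ S p != 0 &
    \sum_(p <- s) S p ^+ d = 1].
Proof.
move=> d0 S0 /finite_seqP[s sE] nS; exists (undup s).
have us := undup_uniq s.
have mems p : p \in undup s <-> J p /\ S p != 0.
  by rewrite mem_undup; have : [set` s] p <-> J p /\ S p != 0 by rewrite -sE.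
split=> //; move: nS; rewrite /norm_d.
rewrite (@fsbigE _ _ _ _ J (undup s)) //; last 2 first.
- by move=> p /mems[].
- move=> p Jp; apply: contraNeq => Sp; apply/mems; split => //.
  by apply: contraNneq Sp => ->; rewrite expr0n gtn_eqF.
(* A real power of a negative number is 1 by convention; the nonnegativity of S excludes this second
   case. *)
move/eqP; rewrite powR_eq1 invr_eq0 pnatr_eq0 (gtn_eqF d0) orbF => /orP[/eqP|].
  rewrite big_seq_cond (eq_bigl (mem (undup s))) => [|p]; first by rewrite -big_seq.
  by rewrite /=; case: (boolP (p \in undup s)) => // /mems[Jp _]; rewrite mem_set.
by rewrite ltNge sumr_ge0 // => p /set_mem/S0 Sp; rewrite exprn_ge0.
Qed.

Theorem theorem2 (R : realType) (n : nat) (hn : (1 <= n)%N) :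
  exists C : R,
  forall (F : fieldType) (d : nat) (k : 'I_d -> nat)
    (hk : forall j, (1 <= k j)%N) (hsum : (\sum_(j < d) k j)%N = n)
    (Pi : forall j : 'I_d, set (aplane F n (k j)))
    (S : 'rV[F]_n -> R),
    let J := multijoints Pi in
    (forall p, J p -> 0 <= S p) ->
    finite_set [set p | J p /\ S p != 0] ->
    norm_d J d S = 1 ->
    exists s : forall j : 'I_d, 'rV[F]_n -> Gr F n (k j) -> R,
      [/\ forall j p V, J p -> 0 <= s j p V,
          forall p (pi : forall j, aplane F n (k j)),
            J p -> (forall j, Pi j (pi j)) ->
            (mjkernel p pi)%:R * S p ^+ d
              <= C * \prod_(j < d) s j p (dir (pi j))
        & forall j (pi : aplane F n (k j)),
            Pi j pi -> (aplane_set pi `&` J) !=set0 ->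
            (\esum_(p in aplane_set pi `&` J) (s j p (dir pi))%:E)%E = 1%:E].
Proof.
(* The 2 is the loss in [balanced_delays]; n! compares the product of the dimensions on the flats
   with 'C(n + D, n). *)
exists (2 * n`!%:R) => F d k _ kn Pi S J S0 finS nS.
have d0 : (0 < d)%N.
  rewrite lt0n; apply: contraTneq hn => d0; rewrite -kn.
  by move: k {kn Pi J S0 finS nS}; rewrite d0 => k; rewrite big_ord0.
have [s [us mems sums]] := norm_d_eq1 d0 S0 finS nS.
pose m := size s; pose X (i : 'I_m) := nth 0 s i; pose w i := S (X i) ^+ d.
have Xs i : X i \in s by rewrite mem_nth.
have XJ i : J (X i) by have /mems[] := Xs i.
have Xinj : injective X.
  by move=> i i' /eqP; rewrite nth_uniq // => /eqP/val_inj.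
have w0 i : 0 <= w i by rewrite exprn_ge0 ?S0.
have w1 : \sum_i w i <= 1 by rewrite -sums (big_nth 0) big_mkord.
have [io io_bij] := block_bij kn.
have [D [be bal]] := balanced_delays kn io_bij Xinj w0 w1.
pose N j : R := 'C(k j + D, k j)%:R.
have N0 j : 0 < N j by rewrite ltr0n bin_gt0 leq_addr.
(* The share of the point [X i] in the dimension on its flat. It depends on the flat only through
   the direction V, as the weights must. *)
pose t j (V : Gr F n (k j)) i : R := (bflat X D be (gr_mx V) (pinvmx (gr_mx V)) i)%:R / N j.
have t0 j V i : 0 <= t j V i by rewrite divr_ge0 // ltW.
pose tau j V (A : set 'rV[F]_n) := \sum_(i | X i \in A) t j V i.
have tau1 j V p : tau j V (translate p V) <= 1.
  have [i0 i0P|none] := pickP (fun i => X i \in translate p V); last first.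
    by rewrite /tau big_pred0.
  rewrite /tau -mulr_suml ler_pdivrMr // mul1r -natr_sum ler_nat -nmonE.
  apply: leq_trans (sum_bflat_le X (gr_mx V) (pinvmx (gr_mx V)) D be i0).
  rewrite [leqRHS](bigID (fun i => X i \in translate p V)) /=.
  rewrite [X in (_ <= X + _)%N](eq_bigl (fun i => X i \in translate p V)) ?leq_addr // => i.
  case: (boolP (X i \in _)) => [/set_mem iP|]; rewrite ?andbF ?andbT // inE; apply/eqP.
  apply: mulmxKpV; apply: gr_mxP.
  have [u /= uV <-] := iP; have [v /= vV <-] := set_mem i0P.
  by rewrite opprD addrACA subrr add0r memvB.
(* The choice depends only on the set [translate p V], so all points of a flat select the same
   joint, possibly outside the support of S. The default 0 is taken only on flats without joints. *)
pose star j (V : Gr F n (k j)) p := xget 0 (translate p V `&` J).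
(* The last summand tops up the mass of each flat at one of its joints. *)
pose sig j p (V : Gr F n (k j)) : R := \sum_i (if p == X i then t j V i else 0) +
  (if p == star j V p then 1 - tau j V (translate p V) else 0).
have base0 j p V : 0 <= \sum_i (if p == X i then t j V i else 0).
  by apply: sumr_ge0 => i _; case: ifP.
have pad0 j p V : 0 <= (if p == star j V p then 1 - tau j V (translate p V) else 0).
  by case: ifP => // _; rewrite subr_ge0.
exists sig; split => [j p V _|p pi Jp _|j pi _ [p0 [p0pi Jp0]]].
- exact: addr_ge0.
- have sig0 : 0 <= 2 * n`!%:R * \prod_(j < d) sig j p (dir (pi j)).
    by rewrite !mulr_ge0 // prodr_ge0 // => j _; apply: addr_ge0.
  have [->|Sp] := eqVneq (S p) 0; first by rewrite expr0n gtn_eqF // mulr0.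
  have [i pE] : exists i, p = X i.
    have /mems ps : J p /\ S p != 0 by [].
    have ip : (index p s < m)%N by rewrite index_mem.
    by exists (Ordinal ip); rewrite /X nth_index.
  rewrite /mjkernel; have [wd|] := eqVneq (wedge (fun j => dir (pi j))) 1%N; last first.
    rewrite {1}/wedge; case: ifP => [_|fV]; first by rewrite eqxx.
    by rewrite /wedge fV muln0 mul0r.
  rewrite wd muln1; apply: le_trans (_ : S p ^+ d <= _).
    rewrite -[leRHS]mul1r ler_wpM2r ?exprn_ge0 ?S0 // lern1.
    apply: (@leq_trans (\prod_(j < d) 1)%N); last by rewrite big1.
    by apply: leq_prod => j _; apply: leq_b1.
  have := bal i _ (fun j => pinvmx (gr_mx (dir (pi j)))) (frame_gr_mx io_bij wd).
  rewrite natr_prod => h1.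
  have h2 : \prod_j N j <= n`!%:R * 'C(n + D, n)%:R.
    rewrite -natr_prod -natrM ler_nat; apply: leq_trans (exp_le_bin n D).
    by rewrite -kn expn_sum; apply: leq_prod => j _; apply: bin_le_exp.
  have h3 : \prod_(j < d) (bflat X D be (gr_mx (dir (pi j))) (pinvmx (gr_mx (dir (pi j)))) i)%:R
      = \prod_j N j * \prod_j t j (dir (pi j)) i :> R.
    by rewrite -big_split; apply: eq_bigr => j _; rewrite /= mulrC divfK // gt_eqF.
  have T0 : 0 < 'C(n + D, n)%:R :> R by rewrite ltr0n bin_gt0 leq_addr.
  have t00 : 0 <= \prod_j t j (dir (pi j)) i by apply: prodr_ge0.
  have h4 : \prod_j t j (dir (pi j)) i <= \prod_j sig j p (dir (pi j)).
    apply: ler_prod => j _; rewrite t0 /=.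
    apply: le_trans (_ : \sum_i' (if p == X i' then t j (dir (pi j)) i' else 0) <= _).
      by rewrite (bigD1 i) //= pE eqxx lerDl sumr_ge0 // => i' _; case: ifP.
    by rewrite lerDl.
  apply: le_trans (ler_wpM2l _ h4); last by rewrite mulr_ge0.
  have := le_trans h1 (eq_ind_r (fun x => x <= _) (ler_wpM2r t00 h2) h3).
  rewrite -[w i](_ : S p ^+ d = _) ?pE //; set W := S _ ^+ d; set P := \prod_j t _ _ _.
  move=> h5; rewrite -(ler_pM2r T0); lra.
- have piE : aplane_set pi = translate p0 (dir pi).
    have [q qE] := dir_translate pi; rewrite qE.
    by rewrite -(@translate_eq _ _ _ (dir pi) q p0) // -qE.
  set V := dir pi in piE *; set A := _ `&` J.
  have AE p : A p -> translate p V = translate p0 V.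
    by move=> [pA _]; apply: translate_eq; rewrite -piE.
  pose a := xget 0 A; have aA : A a by apply: xgetPex; exists p0.
  transitivity (\esum_(p in A) ((\sum_i (if p == X i then t j V i else 0)%:E) +
      (if p == a then 1 - tau j V (translate p0 V) else 0)%:E))%E.
    apply: eq_esum => p pA; rewrite /sig EFinD sumEFin; congr (_ + _)%E.
    by rewrite /star (AE p pA) -piE.
  rewrite esumD; last 2 first.
  + by move=> p _; rewrite sumEFin lee_fin.
  + by move=> p _; rewrite lee_fin; case: ifP => // _; rewrite subr_ge0.
  rewrite esum_sum => [|p i _ _]; last by rewrite lee_fin; case: ifP.
  rewrite esum_point ?subr_ge0 // mem_set //.
  under eq_bigr => i _ do rewrite esum_point //.
  rewrite sumEFin -EFinD; congr (_%:E); rewrite /tau -big_mkcond /= addrC.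
  rewrite [X in _ + X = _](eq_bigl (fun i => X i \in translate p0 V)) ?subrK // => i.
  by apply/idP/idP => /set_mem iP; apply: mem_set; [rewrite -piE; case: iP|split; rewrite ?piE].
Qed.
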